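(* Let $n\ge 3$ be an integer, $0<m<\frac{n-2}{n}$, $\gamma=\frac{2}{1-m}$, $\alpha,\beta\in\mathbb{R}$, $\eta>0$ and $\varepsilon>0$. Let $B_{\varepsilon}=\{x\in\mathbb{R}^n:|x|<\varepsilon\}$. Suppose there exists a radially symmetric solution $f$ of $$\Delta (f^m/m)+\alpha f+\beta x\cdot\nabla f=0,\quad f>0,\quad\text{ in }B_{\varepsilon}\setminus\{0\}$$ which satisfies $$\lim_{|x|\to 0}|x|^{\gamma}f(x)=\eta.$$ Then $$\left(\alpha-\frac{2\beta}{1-m}\right)\eta^{1-m}=\frac{2(n-2-nm)}{(1-m)^2}.$$
   Context: ''Solution'' means a classical (twice continuously differentiable) positive function satisfying the equation pointwise on the indicated punctured ball. Radially symmetric means that $f(x)$ depends only on $|x|$. *)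

(* Defs.v *)
From mathcomp Require Import all_boot all_order all_algebra.
From mathcomp Require Import all_classical all_reals all_analysis.

Set Implicit Arguments.
Unset Strict Implicit.
Unset Printing Implicit Defensive.

Import Order.TTheory GRing.Theory Num.Theory.
Import numFieldNormedType.Exports.

Local Open Scope classical_set_scope.
Local Open Scope ring_scope.

Definition dotprod (R : realType) (n : nat) (x y : 'rV[R]_n) : R :=
  \sum_(i < n) x 0 i * y 0 i.

(* The canonical norm `|x| on 'rV[R]_n is the sup norm; it induces the same
   topology as the Euclidean norm below, but not the same balls. *)
Definition enorm (R : realType) (n : nat) (x : 'rV[R]_n) : R :=
  Num.sqrt (dotprod x x).

Definition punctured_ball (R : realType) (n : nat) (r : R) : set 'rV[R]_n :=
  [set x | enorm x < r /\ x <> 0].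
Arguments punctured_ball {R} n r.

Definition partial (R : realType) (n : nat) (i : 'I_n) (u : 'rV[R]_n -> R) :
  'rV[R]_n -> R := fun x => 'D_(delta_mx 0 i) u x.

Definition gradient (R : realType) (n : nat) (u : 'rV[R]_n -> R)
  (x : 'rV[R]_n) : 'rV[R]_n := \row_(i < n) partial i u x.

Definition laplacian (R : realType) (n : nat) (u : 'rV[R]_n -> R)
  (x : 'rV[R]_n) : R := \sum_(i < n) partial i (partial i u) x.

(* Meant for open sets U. The operator 'D_v u is total, hence the explicit
   existence of the first and second partial derivatives. *)
Definition twice_cont_diff (R : realType) (n : nat) (U : set 'rV[R]_n)
    (u : 'rV[R]_n -> R) : Prop :=
  forall x, U x ->
    [/\ {for x, continuous u},
        forall i, derivable u x (delta_mx 0 i),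
        forall i, {for x, continuous (partial i u)},
        forall i j, derivable (partial i u) x (delta_mx 0 j) &
        forall i j, {for x, continuous (partial j (partial i u))}].

Definition radial_on (R : realType) (n : nat) (U : set 'rV[R]_n)
    (u : 'rV[R]_n -> R) : Prop :=
  forall x y, U x -> U y -> enorm x = enorm y -> u x = u y.

(* Classical positive solutions of
   Delta (f^m / m) + alpha f + beta x . grad f = 0 in U. *)
Definition is_solution (R : realType) (n : nat) (m alpha beta : R)
    (U : set 'rV[R]_n) (f : 'rV[R]_n -> R) : Prop :=
  [/\ twice_cont_diff U f,
      forall x, U x -> 0 < f x &
      forall x, U x ->
        laplacian (fun y => f y `^ m / m) x + alpha * f x
          + beta * dotprod x (gradient f x) = 0].

(* Main.v *)
Require Import Defs.
From mathcomp Require Import all_boot all_order all_algebra.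
From mathcomp Require Import all_classical all_reals all_analysis.
From mathcomp Require Import ring lra.

Set Implicit Arguments.
Unset Strict Implicit.
Unset Printing Implicit Defensive.

Import Order.TTheory GRing.Theory Num.Theory.
Import numFieldNormedType.Exports.

Local Open Scope classical_set_scope.
Local Open Scope ring_scope.

(** Write a radial solution as [f x = phi |x|] and put [r = expR s],
[w s = r ^ gamma * phi r], [V s = r ^ (gamma - 2) * phi r ^ m / m].  The exponent
[gamma = 2 / (1 - m)] satisfies [gamma - 2 = m * gamma], so that [V = w ^ m / m],
and all three terms of the equation scale in the same way under dilations.
In the variable [s] the equation is therefore autonomous:
[V'' + a V' + b V + c w + beta w' = 0] with [c = alpha - beta * gamma],
[g = gamma - 2], [a = n - 2 - 2 g] and [b = g ^ 2 - (n - 2) g].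

As [s] tends to [-oo], [w] tends to [eta] and [V] to [eta ^ m / m].  The limit
has to be an equilibrium, i.e. [b * (eta ^ m / m) + c * eta = 0], and this is the
claim after division by [eta ^ m].  The reason is that
[G = V' + a V + beta w] has derivative [- (b V + c w)], which converges; were its
limit not zero, [G] would diverge, hence so would [V'], since [V] and [w] are
bounded, and then [V] itself, which converges ([steady_limit]).

The passage from the partial differential equation to the ordinary one is done
on the first coordinate axis only ([laplacian_radial]): there the second
derivative along the axis is the radial one, and each of the other [n - 1]
directions contributes [F' r / r], because on the line [r e_0 + t e_j] a radial
function is a function of [sqrt (r ^ 2 + t ^ 2)]. *)

(** * Directional derivatives as derivatives of one real variable *)

Lemma is_derive_lineE (R : realType) (V : normedModType R) (u : V -> R)
    (x v : V) (t d : R) :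
  is_derive (x + t *: v) v u d <-> is_derive t 1 (fun s : R => u (x + s *: v)) d.
Proof.
have E : (fun h : R => h^-1 *: ((u \o shift (x + t *: v)) (h *: v) - u (x + t *: v)))
  = (fun h : R => h^-1 *: (((fun s : R => u (x + s *: v)) \o shift t) (h *: (1 : R))
        - (fun s : R => u (x + s *: v)) t)).
  apply/funext => h /=; congr (_ *: (u _ - _)).
  by rewrite [h *: 1]mulr1 scalerDl addrCA.
have dE : derivable u (x + t *: v) v = derivable (fun s : R => u (x + s *: v)) t 1.
  by rewrite /derivable E.
have DE : 'D_v u (x + t *: v) = 'D_1 (fun s : R => u (x + s *: v)) t.
  by rewrite /derive E.
by split=> -[]; [rewrite dE DE | rewrite -dE -DE]; split.
Qed.

Lemma is_derive_axis (R : realType) n (u : 'rV[R]_n -> R) (i : 'I_n) (t : R) :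
  derivable u (t *: delta_mx 0 i) (delta_mx 0 i) ->
  is_derive t (1 : R) (fun s : R => u (s *: delta_mx 0 i))
    (partial i u (t *: delta_mx 0 i)).
Proof.
move=> du.
have -> : (fun s : R => u (s *: delta_mx 0 i)) =
    (fun s : R => u (0 + s *: delta_mx 0 i)).
  by apply/funext => s; rewrite add0r.
have H : is_derive (0 + t *: delta_mx 0 i : 'rV[R]_n) (delta_mx 0 i) u
    (partial i u (t *: delta_mx 0 i)).
  by rewrite add0r; split.
exact: (iffLR (is_derive_lineE u 0 _ _ _) H).
Qed.

(** * The Euclidean norm on coordinate axes and planes *)

Lemma dotprodZl (R : realType) n (x y : 'rV[R]_n) (c : R):
  dotprod (c *: x) y = c * dotprod x y.
Proof. by rewrite mulr_sumr; apply: eq_bigr => i _; rewrite mxE mulrA. Qed.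

Lemma dotprodDl (R : realType) n (x y z : 'rV[R]_n) :
  dotprod (x + y) z = dotprod x z + dotprod y z.
Proof. by rewrite -big_split; apply: eq_bigr => i _; rewrite mxE mulrDl. Qed.

Lemma dotprod_delta (R : realType) n (y : 'rV[R]_n) (i : 'I_n) :
  dotprod (delta_mx 0 i) y = y 0 i.
Proof.
rewrite /dotprod (bigD1 i)//= big1 => [|j ji]; rewrite !mxE ?eqxx /=.
  by rewrite mul1r addr0.
by rewrite (negPf ji) mul0r.
Qed.

Lemma enorm_plane (R : realType) n (i j : 'I_n) (r s : R) : i != j ->
  enorm (r *: delta_mx 0 i + s *: delta_mx 0 j) = Num.sqrt (r ^+ 2 + s ^+ 2).
Proof.
move=> ij; congr Num.sqrt.
rewrite dotprodDl !dotprodZl !dotprod_delta !mxE !eqxx (negPf ij) eq_sym.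
rewrite (negPf ij) /=.
ring.
Qed.

Lemma enorm_axis (R : realType) n (i : 'I_n) (r : R) : 0 <= r ->
  enorm (r *: delta_mx 0 i) = r.
Proof.
move=> r0; rewrite /enorm dotprodZl dotprod_delta !mxE !eqxx mulr1.
by rewrite -expr2 sqrtr_sqr ger0_norm.
Qed.

Lemma dotprod_gradient_axis (R : realType) n (r : R) (i : 'I_n)
    (u : 'rV[R]_n -> R) x :
  dotprod (r *: delta_mx 0 i) (gradient u x) = r * partial i u x.
Proof. by rewrite dotprodZl dotprod_delta mxE. Qed.

(** * The Laplacian of a radial function on an axis *)

Lemma is_derive_hypot (R : realType) (r t : R) : 0 < r ->
  is_derive t (1 : R) (fun s : R => Num.sqrt (r ^+ 2 + s ^+ 2))
    (t / Num.sqrt (r ^+ 2 + t ^+ 2)).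
Proof.
move=> r0; have P : 0 < r ^+ 2 + t ^+ 2 by nra.
have D : is_derive t (1 : R) (fun s : R => r ^+ 2 + s ^+ 2) (2 * t).
  by apply: is_derive_eq; rewrite /GRing.scale /=; ring.
have S := is_derive1_sqrt P.
have H := @is_derive1_comp R _ (fun s : R => r ^+ 2 + s ^+ 2) t _ _ S D.
apply: (is_derive_eq H).
by field; rewrite gt_eqF// sqrtr_gt0.
Qed.

Lemma near_hypot_lt (R : realType) (r t eps : R) : 0 < r ->
  Num.sqrt (r ^+ 2 + t ^+ 2) < eps ->
  \forall s \near t, Num.sqrt (r ^+ 2 + s ^+ 2) < eps.
Proof.
move=> r0 te.
have c : {for t, continuous (fun s : R => Num.sqrt (r ^+ 2 + s ^+ 2))}.
  apply/differentiable_continuous/derivable1_diffP.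
  exact: (ex_derive (is_derive := is_derive_hypot t r0)).
exact: (cvgr_lt _ c).
Qed.

(** Radiality gives [F (r e_0 + s e_j) = F (sqrt (r ^ 2 + s ^ 2) e_0)] for [s]
near [t]; the chain rule then produces the factor [t / sqrt (r ^ 2 + t ^ 2)]. *)
Lemma partial_radial_tangent (R : realType) n (eps r t : R)
    (F : 'rV[R]_n.+1 -> R) (dF : R -> R) (j : 'I_n.+1) :
  radial_on (punctured_ball n.+1 eps) F ->
  (forall s : R, 0 < s < eps ->
    is_derive s (1 : R) (fun s : R => F (s *: delta_mx 0 0)) (dF s)) ->
  j != 0 -> 0 < r -> Num.sqrt (r ^+ 2 + t ^+ 2) < eps ->
  partial j F (r *: delta_mx 0 0 + t *: delta_mx 0 j) =
     dF (Num.sqrt (r ^+ 2 + t ^+ 2)) * (t / Num.sqrt (r ^+ 2 + t ^+ 2)).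
Proof.
move=> rad dF_ j0 r0 re.
have pos (s : R) : 0 < Num.sqrt (r ^+ 2 + s ^+ 2) by rewrite sqrtr_gt0; nra.
have rho : 0 < Num.sqrt (r ^+ 2 + t ^+ 2) < eps by rewrite pos.
have D := @is_derive1_comp R _ (fun s : R => Num.sqrt (r ^+ 2 + s ^+ 2)) t _ _
  (dF_ _ rho) (is_derive_hypot t r0).
suff : is_derive (r *: delta_mx 0 0 + t *: delta_mx 0 j : 'rV[R]_n.+1)
    (delta_mx 0 j) F (dF (Num.sqrt (r ^+ 2 + t ^+ 2)) *
      (t / Num.sqrt (r ^+ 2 + t ^+ 2))).
  by move=> H; exact: derive_val.
apply/is_derive_lineE; apply: near_eq_is_derive D.
apply: filterS (near_hypot_lt r0 re) => s se /=.
have nz (x : 'rV[R]_n.+1) : 0 < enorm x -> x <> 0.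
  move=> + x0; rewrite x0 /enorm (_ : dotprod _ _ = 0) ?sqrtr0 ?ltxx//.
  by rewrite /dotprod big1// => i _; rewrite mxE mul0r.
have ij : (0 : 'I_n.+1) != j by rewrite eq_sym.
have E1 := @enorm_axis R n.+1 0 (Num.sqrt (r ^+ 2 + s ^+ 2)) (ltW (pos s)).
have E2 := enorm_plane r s ij.
apply: rad.
- by split; [rewrite E1 | apply: nz; rewrite E1].
- by split; [rewrite E2 | apply: nz; rewrite E2].
- by rewrite E1 E2.
Qed.

(** The tangential first derivative [dF rho * (t / rho)], with
[rho = sqrt (r ^ 2 + t ^ 2)], vanishes at [t = 0], and [rho] is stationary there;
so its derivative at [0] is [dF r / r], without a contribution of [d]. *)
Lemma laplacian_radial (R : realType) n (eps r d : R)
    (F : 'rV[R]_n.+1 -> R) (dF : R -> R) :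
  radial_on (punctured_ball n.+1 eps) F ->
  (forall s : R, 0 < s < eps ->
    is_derive s (1 : R) (fun s : R => F (s *: delta_mx 0 0)) (dF s)) ->
  0 < r < eps -> is_derive r (1 : R) dF d ->
  laplacian F (r *: delta_mx 0 0) = d + n%:R * (dF r / r).
Proof.
move=> rad dF_ re dd; rewrite /laplacian big_ord_recl.
have [r0 _] := andP re.
congr (_ + _).
  (* The axis is the line through 0, and 0 + r e_0 is its point at parameter r. *)
  rewrite -[r *: _]add0r.
  suff : is_derive (0 + r *: delta_mx 0 0 : 'rV[R]_n.+1) (delta_mx 0 0) (partial 0 F) d.
    by move=> H; exact: derive_val.
  apply/is_derive_lineE; apply: near_eq_is_derive dd.
  have : \forall s \near r, 0 < s < eps.
    have [_ r_lt] := andP re.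
    by near=> s; apply/andP; split; near: s; [exact: lt_nbhsr | exact: lt_nbhsl].
  apply: filterS => s /dF_ H; rewrite add0r; apply/esym.
  suff : is_derive (0 + s *: delta_mx 0 0 : 'rV[R]_n.+1) (delta_mx 0 0) F (dF s).
    by rewrite add0r => H'; exact: derive_val.
  by apply/is_derive_lineE; under eq_fun do rewrite add0r.
under eq_bigr => i _.
  set j := lift _ _.
  have -> : partial j (partial j F) (r *: delta_mx 0 0) = dF r / r.
    rewrite -[r *: _]addr0 -(scale0r (delta_mx 0 j)).
    set x := (X in partial _ _ X).
    suff : is_derive x (delta_mx 0 j) (partial j F) (dF r / r).
      by move=> H; exact: derive_val.
    apply/is_derive_lineE.
    have S0 : Num.sqrt (r ^+ 2 + 0 ^+ 2) = r.
      by rewrite expr0n addr0 sqrtr_sqr gtr0_norm.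
    apply: near_eq_is_derive.
      have lt0 : Num.sqrt (r ^+ 2 + 0 ^+ 2) < eps by rewrite S0; case/andP: re.
      apply: filterS (near_hypot_lt r0 lt0) => t te.
      by rewrite (partial_radial_tangent rad dF_).
    have D1 := is_derive_hypot 0 r0.
    have D2 : is_derive (0 : R) (1 : R) (fun t : R => dF (Num.sqrt (r ^+ 2 + t ^+ 2)))
        (d * (0 / Num.sqrt (r ^+ 2 + 0 ^+ 2))).
      apply: (@is_derive1_comp R dF (fun t : R => Num.sqrt (r ^+ 2 + t ^+ 2))).
      by rewrite S0.
    have D3 := @is_deriveV R (fun t : R => Num.sqrt (r ^+ 2 + t ^+ 2)) 0 _ 1 _ D1.
    apply: is_derive_eq.
      apply: is_deriveM; apply: is_deriveM.
      by apply: D3; rewrite S0 gt_eqF.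
    by rewrite /GRing.scale /= S0; field; exact: lt0r_neq0.
  over.
by rewrite big_const_ord iter_addr_0 mulr_natl.
Unshelve. all: by end_near. Qed.

(** * Limits of solutions of an autonomous equation *)

Lemma derive_ge_cvgNy (R : realType) (h dh : R -> R) (c : R) : 0 < c ->
  (\forall s \near -oo, is_derive s (1 : R) h (dh s) /\ c <= dh s) ->
  h s @[s --> -oo] --> -oo.
Proof.
move=> c0 [M [_ hM]].
pose b := M - 1.
have hb s : s <= b -> is_derive s (1 : R) h (dh s) /\ c <= dh s.
  by move=> sb; apply: hM; rewrite /b in sb; lra.
have bound s : s < b -> h s <= h b - c * (b - s).
  move=> sb.
  have [t | |t] := @MVT R h dh s b sb.
  - by rewrite in_itv/= => /andP[_ /ltW/hb[]].
  - apply: derivable_within_continuous => t.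
    by rewrite in_itv/= => /andP[_ /hb[[]]].
  - rewrite in_itv/= => /andP[_ /ltW/hb[_ ct]] E.
    have : c * (b - s) <= dh t * (b - s) by rewrite ler_wpM2r// subr_ge0 ltW.
    rewrite -E; lra.
apply/cvgrNyPle => A; near=> s.
apply: (le_trans (bound s _)).
  by near: s; apply: nbhs_ninfty_lt; apply: num_real.
have : s <= b - (h b - A) / c by near: s; apply: nbhs_ninfty_le; apply: num_real.
rewrite -lerBrDr => /(ler_wpM2l (ltW c0)) => ?.
have : c * ((h b - A) / c) = h b - A by rewrite mulrC divfK ?gt_eqF.
nra.
Unshelve. all: by end_near. Qed.

(** One sign of [steady_limit]; the other one follows by passing to [- V] and
[- w]. *)
Lemma steady_limit_ge0 (R : realType) (V dV ddV w dw : R -> R)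
    (a b c k v0 w0 : R) :
  (\forall s \near -oo, [/\ is_derive s (1 : R) V (dV s),
     is_derive s (1 : R) dV (ddV s), is_derive s (1 : R) w (dw s) &
     ddV s + a * dV s + b * V s + c * w s + k * dw s = 0]) ->
  V s @[s --> -oo] --> v0 -> w s @[s --> -oo] --> w0 -> 0 <= b * v0 + c * w0.
Proof.
move=> ode Vv ww; rewrite leNgt; apply/negP => L0.
pose G s := dV s + a * V s + k * w s.
have lim_bc : b * V s + c * w s @[s --> -oo] --> b * v0 + c * w0.
  by apply: cvgD; apply: cvgMr.
pose l := - (b * v0 + c * w0) / 2.
have l0 : 0 < l by rewrite /l; lra.
have lt_l : b * v0 + c * w0 < - l by rewrite /l; lra.
(* The derivative of G is - (b V + c w), which is eventually above l > 0. *)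
have GNy : G s @[s --> -oo] --> -oo.
  apply: (derive_ge_cvgNy (dh := fun s => ddV s + a * dV s + k * dw s) l0).
  near=> s.
  have [DV DdV Dw E] : [/\ is_derive s (1 : R) V (dV s),
     is_derive s (1 : R) dV (ddV s), is_derive s (1 : R) w (dw s) &
     ddV s + a * dV s + b * V s + c * w s + k * dw s = 0] by near: s.
  split; last first.
    have : b * V s + c * w s < - l by near: s; apply: (cvgr_lt _ lim_bc).
    by move: E; lra.
  by apply: is_derive_eq; rewrite /GRing.scale.
(* dV = G - (a V + k w), and the subtracted term is bounded. *)
have VNy : - V s @[s --> -oo] --> -oo.
  apply: (derive_ge_cvgNy (dh := fun s => - dV s) ltr01).
  have lim_ak : - (a * V s + k * w s) @[s --> -oo] --> - (a * v0 + k * w0).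
    by apply: cvgN; apply: cvgD; apply: cvgMr.
  near=> s.
  have [DV _ _ _] : [/\ is_derive s (1 : R) V (dV s),
     is_derive s (1 : R) dV (ddV s), is_derive s (1 : R) w (dw s) &
     ddV s + a * dV s + b * V s + c * w s + k * dw s = 0] by near: s.
  split; first exact: is_deriveN.
  have : - (a * V s + k * w s) < - (a * v0 + k * w0) + 1.
    by near: s; apply: (cvgr_lt _ lim_ak); rewrite ltrDl.
  have : G s <= - 1 + (a * v0 + k * w0) - 1.
    by near: s; apply: (cvgrNy_le GNy).
  by rewrite /G; lra.
near (-oo : set_system R) => s.
have : - V s <= - (v0 + 1) by near: s; apply: (cvgrNy_le VNy).
have : V s < v0 + 1 by near: s; apply: (cvgr_lt _ Vv); rewrite ltrDl.
by lra.
Unshelve. all: by end_near. Qed.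

(** If [b * v0 + c * w0] were not zero, [G = dV + a V + k w] would have a
derivative bounded away from [0] with constant sign and would diverge; as [V] and
[w] converge, so would [dV], and then [V]. *)
Lemma steady_limit (R : realType) (V dV ddV w dw : R -> R)
    (a b c k v0 w0 : R) :
  (\forall s \near -oo, [/\ is_derive s (1 : R) V (dV s),
     is_derive s (1 : R) dV (ddV s), is_derive s (1 : R) w (dw s) &
     ddV s + a * dV s + b * V s + c * w s + k * dw s = 0]) ->
  V s @[s --> -oo] --> v0 -> w s @[s --> -oo] --> w0 -> b * v0 + c * w0 = 0.
Proof.
move=> ode Vv ww; apply/eqP; rewrite eq_le (steady_limit_ge0 ode Vv ww) andbT.
rewrite -oppr_ge0 opprD -!mulrN.
apply: (@steady_limit_ge0 R (- V) (- dV) (- ddV) (- w) (- dw) a b c k).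
- apply: filterS ode => s [DV DdV Dw E]; split; try exact: is_deriveN.
  by rewrite !fctE; move: E; lra.
- exact: cvgN.
- exact: cvgN.
Qed.

(** * Logarithmic radial variable *)

Lemma is_derive_expRM_comp (R : realType) (g : R -> R) (c s d : R) :
  is_derive (expR s) (1 : R) g d ->
  is_derive s (1 : R) (fun s : R => expR (c * s) * g (expR s))
    (expR (c * s) * (c * g (expR s) + expR s * d)).
Proof.
move=> gd.
have D1 := @is_derive1_comp R g expR s _ _ gd (is_derive_expR s).
have D2 : is_derive s (1 : R) (fun s : R => c * s) c.
  by apply: is_derive_eq; rewrite /GRing.scale /= mulr1.
have D3 := @is_derive1_comp R expR (fun s : R => c * s) s _ _ (is_derive_expR _) D2.
by apply: (is_derive_eq (is_deriveM D3 D1)); rewrite /GRing.scale /=; ring.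
Qed.

Lemma cvg_expRNy (R : realType) : expR s @[s --> (-oo : set_system R)] --> (0 : R).
Proof. by apply/cvgNy_compNP; exact: cvgr_expR. Qed.

Lemma cvg_expR_axis (R : realType) n (v : 'rV[R]_n) : v != 0 ->
  expR s *: v @[s --> -oo] --> (0 : 'rV[R]_n)^'.
Proof.
move=> v0 A; rewrite /dnbhs /within /= => A0.
have c : expR s *: v @[s --> (-oo : set_system R)] --> (0 : 'rV[R]_n).
  by rewrite -(scale0r v); apply: cvgZr_tmp; exact: cvg_expRNy.
have cA : \forall s \near -oo, expR s *: v != 0 -> A (expR s *: v) := c _ A0.
apply: filterS cA => s; apply.
by rewrite scaler_eq0 negb_or v0 gt_eqF// expR_gt0.
Qed.

(** The substitution [r = expR s] makes the radial equation autonomous, for an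
arbitrary pair of profiles [Phi] and [phi]: the weights [r ^ (gamma - 2)] and
[r ^ gamma] compensate the two derivatives that fall on [Phi] only. *)
Lemma emden_fowler_limit (R : realType) (k alpha beta gamma eps v0 w0 : R)
    (phi phi1 Phi Phi1 Phi2 : R -> R) : 0 < eps ->
  (forall r, 0 < r < eps -> is_derive r (1 : R) phi (phi1 r)) ->
  (forall r, 0 < r < eps -> is_derive r (1 : R) Phi (Phi1 r)) ->
  (forall r, 0 < r < eps -> is_derive r (1 : R) Phi1 (Phi2 r)) ->
  (forall r, 0 < r < eps ->
    Phi2 r + k * (Phi1 r / r) + alpha * phi r + beta * (r * phi1 r) = 0) ->
  expR ((gamma - 2) * s) * Phi (expR s) @[s --> -oo] --> v0 ->
  expR (gamma * s) * phi (expR s) @[s --> -oo] --> w0 ->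
  ((gamma - 2) ^+ 2 - (k - 1) * (gamma - 2)) * v0
    + (alpha - beta * gamma) * w0 = 0.
Proof.
move=> heps Dphi DPhi DPhi1 ode; set g := gamma - 2.
pose V s := expR (g * s) * Phi (expR s).
pose w s := expR (gamma * s) * phi (expR s).
move=> Vlim wlim.
pose dV s := expR (g * s) * (g * Phi (expR s) + expR s * Phi1 (expR s)).
pose ddV s :=
  expR (g * s) * (g * (g * Phi (expR s) + expR s * Phi1 (expR s)) +
  expR s * (g * Phi1 (expR s) + Phi1 (expR s) + expR s * Phi2 (expR s))).
pose dw s :=
  expR (gamma * s) * (gamma * phi (expR s) + expR s * phi1 (expR s)).
have small : \forall s \near (-oo : set_system R), 0 < expR s < eps.
  near=> s; rewrite expR_gt0 /=; near: s.
  exact: (cvgr_lt _ (@cvg_expRNy R)).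
apply: (@steady_limit R V dV ddV w dw (k - 1 - 2 * g) _ _ beta) => //.
apply: filterS small => s se.
have D0 := DPhi _ se; have D1 := DPhi1 _ se.
split.
- exact: is_derive_expRM_comp.
- apply: (@is_derive_expRM_comp R (fun r => g * Phi r + r * Phi1 r)).
  by apply: is_derive_eq; rewrite /GRing.scale /=; ring.
- by apply: is_derive_expRM_comp; exact: Dphi.
- have X0 : expR s != 0 by rewrite gt_eqF// expR_gt0.
  have gam : expR (gamma * s) = expR (g * s) * expR s ^+ 2.
    by rewrite -expRM_natl -expRD /g; congr expR; ring.
  rewrite /ddV /dV /V /w /dw gam.
  have := ode _ se; move: (expR (g * s)) (expR s) X0 => K X X0 E.
  (* The autonomous equation is r ^ gamma times the radial one. *)
  have <- : K * X ^+ 2 * (Phi2 X + k * (Phi1 X / X) + alpha * phi X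
      + beta * (X * phi1 X)) = 0 by rewrite E mulr0.
  by rewrite /g; field.
Unshelve. all: by end_near. Qed.

(** * The identity for the limit *)

Theorem theorem1p2 (R : realType) (n : nat) (m gamma alpha beta eta eps : R)
    (hn : (3 <= n)%N)
    (hm0 : 0 < m) (hm1 : m < (n%:R - 2) / n%:R)
    (hgamma : gamma = 2 / (1 - m))
    (heta : 0 < eta) (heps : 0 < eps) :
  (exists f : 'rV[R]_n -> R,
     [/\ is_solution m alpha beta (punctured_ball n eps) f,
         radial_on (punctured_ball n eps) f &
         enorm x `^ gamma * f x @[x --> (0 : 'rV[R]_n)^'] --> eta]) ->
  (alpha - 2 * beta / (1 - m)) * eta `^ (1 - m)
    = 2 * (n%:R - 2 - n%:R * m) / (1 - m) ^+ 2.
Proof.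
case: n hn hm1 => [//|n] hn hm1 [f [[f2 fpos feq] frad flim]].
have m1 : m < 1.
  apply: (lt_trans hm1); rewrite ltr_pdivrMr ?ltr0n// mul1r; lra.
have om_gt0 : 0 < 1 - m by rewrite subr_gt0.
have om_neq0 : 1 - m != 0 by rewrite gt_eqF.
pose e : 'rV[R]_n.+1 := delta_mx 0 0.
pose phi (r : R) := f (r *: e).
pose phi1 (r : R) := partial 0 f (r *: e).
pose phi2 (r : R) := partial 0 (partial 0 f) (r *: e).
have e_neq0 : e != 0.
  by apply/eqP => /matrixP/(_ 0 0)/eqP; rewrite !mxE !eqxx oner_eq0.
have axisU r : 0 < r < eps -> punctured_ball n.+1 eps (r *: e).
  move=> /andP[r0 re]; split; first by rewrite enorm_axis// ltW.
  by apply/eqP; rewrite scaler_eq0 gt_eqF.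
have phi_gt0 r : 0 < r < eps -> 0 < phi r by move=> /axisU/fpos.
have Dphi r : 0 < r < eps -> is_derive r (1 : R) phi (phi1 r).
  by move=> /axisU/f2[_ d _ _ _]; exact: is_derive_axis.
have Dphi1 r : 0 < r < eps -> is_derive r (1 : R) phi1 (phi2 r).
  by move=> /axisU/f2[_ _ _ d _]; exact: is_derive_axis.
pose F x := f x `^ m / m.
pose Phi (r : R) := phi r `^ m / m.
pose Phi1 (r : R) := phi r `^ (m - 1) * phi1 r.
pose Phi2 (r : R) := (m - 1) * phi r `^ (m - 1 - 1) * phi1 r ^+ 2
  + phi r `^ (m - 1) * phi2 r.
have Dpow (p r : R) : 0 < r < eps ->
    is_derive r (1 : R) (fun s : R => phi s `^ p) (p * phi r `^ (p - 1) * phi1 r).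
  move=> re.
  exact: (@is_derive1_comp R (@powR R ^~ p) phi r _ _
           (is_derive1_powR p (phi_gt0 _ re)) (Dphi _ re)).
have DPhi r : 0 < r < eps -> is_derive r (1 : R) Phi (Phi1 r).
  move=> re; have D1 := Dpow m r re.
  have -> : Phi = (fun s => phi s `^ m) * cst (m^-1) by [].
  apply: is_derive_eq; rewrite /GRing.scale /= /Phi1; field.
  exact: lt0r_neq0.
have DPhi1 r : 0 < r < eps -> is_derive r (1 : R) Phi1 (Phi2 r).
  move=> re; have D1 := Dpow (m - 1) r re; have D2 := Dphi1 r re.
  have -> : Phi1 = (fun s => phi s `^ (m - 1)) * phi1 by [].
  by apply: is_derive_eq; rewrite /GRing.scale /= /Phi2; ring.
have Frad : radial_on (punctured_ball n.+1 eps) F.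
  by move=> x y Ux Uy xy; rewrite /F (frad x y).
have ode r : 0 < r < eps ->
    Phi2 r + n%:R * (Phi1 r / r) + alpha * phi r + beta * (r * phi1 r) = 0.
  move=> re; have := feq _ (axisU _ re).
  by rewrite (laplacian_radial Frad DPhi re (DPhi1 r re)) dotprod_gradient_axis.
have gE : gamma - 2 = m * gamma by rewrite hgamma; field.
pose V s := expR ((gamma - 2) * s) * Phi (expR s).
pose w s := expR (gamma * s) * phi (expR s).
have wlim : w s @[s --> -oo] --> eta.
  have := cvg_comp _ _ (cvg_expR_axis e_neq0) flim.
  apply: cvg_trans; apply: near_eq_cvg; near=> s => /=.
  by rewrite /w enorm_axis ?expR_ge0// /powR gt_eqF ?expR_gt0// expRK.
have Vlim : V s @[s --> -oo] --> eta `^ m / m.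
  have c : {for eta, continuous (@powR R ^~ m)}.
    apply/differentiable_continuous/derivable1_diffP.
    exact: (ex_derive (is_derive := is_derive1_powR m heta)).
  have lim : w s `^ m / m @[s --> -oo] --> eta `^ m / m.
    by apply: cvgMl; exact: (cvg_comp _ _ wlim c).
  apply: cvg_trans lim; apply: near_eq_cvg; near=> s.
  have s0 : 0 < expR s < eps.
    by rewrite expR_gt0 /=; near: s; exact: (cvgr_lt _ (@cvg_expRNy R)).
  rewrite /V /w /Phi powRM ?expR_ge0 ?(ltW (phi_gt0 _ s0))// mulrA.
  congr (_ * _ / _).
  by rewrite /powR gt_eqF ?expR_gt0// expRK mulrA -gE.
have := emden_fowler_limit heps Dphi DPhi DPhi1 ode Vlim wlim.
have eta_split : eta = eta `^ m * eta `^ (1 - m).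
  by rewrite -powRD ?subrKC ?powRr1 ?ltW// gt_eqF ?implybT.
have em0 : eta `^ m != 0 by rewrite gt_eqF// powR_gt0.
rewrite [X in _ + _ * X = 0]eta_split => /eqP; rewrite addrC addr_eq0 => /eqP H.
apply: (mulfI em0).
transitivity ((alpha - beta * gamma) * (eta `^ m * eta `^ (1 - m))).
  by rewrite hgamma; field.
rewrite H hgamma -natr1; field.
by rewrite om_neq0 lt0r_neq0.
Unshelve. all: by end_near. Qed.
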